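(* Let $\lambda>0$, $V=(V^x,V^y)\in\mathbb{R}^2$, $(s_q,s_{xy})\in\mathbb{R}^2$. Consider the twisted $D_2Q_4$ MRT scheme (relative velocity $\tilde u=0$) with relaxation parameters $(0,s_q,s_q,s_{xy})$ and equilibrium moments $m^{eq}(0)=\rho(1,V^x,V^y,V^xV^y)$. Put $W^x=V^x+V^y$, $W^y=V^x-V^y$ and, when $s_{xy}\neq0$, $\gamma=s_q/s_{xy}$. Inequalities containing $\pm$ are required for both signs. \begin{itemize} \item If $0<s_{xy}\le\min(s_q,2-s_q)$, the scheme is $L^\infty$ stable for all $V$ such that $$(W^x\pm2\lambda\gamma)^2-(W^y)^2\ge4\lambda^2(\gamma^2-1),\qquad (W^y\pm2\lambda\gamma)^2-(W^x)^2\ge4\lambda^2(\gamma^2-1).$$ \item If $s_q\le s_{xy}\le2s_q$, $s_q\le1$ and $s_{xy}\ne0$, the scheme is $L^\infty$ stable for all $V$ such that $$(W^x\pm2\lambda\gamma)^2-(W^y)^2\ge4\lambda^2(\gamma-1)^2,\qquad (W^y\pm2\lambda\gamma)^2-(W^x)^2\ge4\lambda^2(\gamma-1)^2.$$ \item If $2-s_q\le s_{xy}\le2(2-s_q)$, $s_q\ge1$ and $s_{xy}\ne0$, the scheme is $L^\infty$ stable for all $V$ such that $$(W^x\pm2\lambda\gamma)^2-(W^y)^2\ge4\lambda^2\Big((\gamma+1)^2-\frac4{s_{xy}}\Big),\qquad (W^y\pm2\lambda\gamma)^2-(W^x)^2\ge4\lambda^2\Big((\gamma+1)^2-\frac4{s_{xy}}\Big).$$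 \item If $s_{xy}=0$ and $0<s_q\le2$, the scheme is $L^\infty$ stable for $V=0$. \item If $s_{xy}=s_q=0$, the scheme is unconditionally $L^\infty$ stable (i.e. for every $V\in\mathbb{R}^2$). \item For all other $(s_q,s_{xy})$, there is no $V$ for which the scheme is $L^\infty$ stable. \end{itemize} In particular, the parameters $(s_q,s_{xy})$ for which the set of $V$ giving an $L^\infty$ stable scheme is non-empty are included in the square $[0,2]^2$.
   Context: Twisted $D_2Q_4$ scheme. Let $\Delta x,\Delta t>0$, $\lambda=\Delta x/\Delta t$, $\mathcal{L}=\Delta x\,\mathbb{Z}^2$. Velocities: $v_0=(\lambda,\lambda)$, $v_1=(-\lambda,\lambda)$, $v_2=(-\lambda,-\lambda)$, $v_3=(\lambda,-\lambda)$. Moment polynomials: $P_0=1$, $P_1=X$, $P_2=Y$, $P_3=XY$. For $\tilde u\in\mathbb{R}^2$, $M(\tilde u)$ is the invertible $4\times4$ matrix $M(\tilde u)_{kj}=P_k(v_j-\tilde u)$. For a distribution vector $f=(f_0,\dots,f_3)$ put $\rho=\sum_jf_j$ and $m=M(\tilde u)f$. One time step of the scheme relative to $\tilde u$ with relaxation parameters $(s_0,\dots,s_3)$ is: relaxation at each node $m_k^*=m_k+s_k(m_k^{eq}-m_k)$, where $m^{eq}$ is a given linear function of $\rho$; $f^*=M(\tilde u)^{-1}m^*$; transport $f_j(x,t+\Delta t)=f_j^*(x-v_j\Delta t,t)$, $x\in\mathcal{L}$. $L^\infty$ stability. The mass is $m_{tot}(t)=\sum_{x\in\mathcal{L}}\sum_jf_j(x,t)$.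 The scheme is $L^\infty$ stable if, for $C>0$ and every initial datum with $f_j(x,0)\ge0$ for all $j$, $x\in\mathcal{L}$ and $m_{tot}(0)\le C$, one has $f_j(x,t^n)\ge0$ for all $j$, $x\in\mathcal{L}$ and $m_{tot}(t^n)\le C$ for all $t^n=n\Delta t$, $n\in\mathbb{N}$. *)

(* Defs.v *)
From mathcomp Require Import all_boot all_order all_algebra.
From mathcomp Require Import all_classical all_reals all_analysis.

Set Implicit Arguments.
Unset Strict Implicit.
Unset Printing Implicit Defensive.

Import Order.TTheory GRing.Theory Num.Theory.

Local Open Scope classical_set_scope.
Local Open Scope ring_scope.

Section D2Q4.
Variable R : realType.

Definition vec2 (a b : R) : 'rV[R]_2 := \row_(i < 2) [:: a; b]`_i.

Definition lattice (dx : R) : set 'rV[R]_2 :=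
  [set dx *: vec2 p.1%:~R p.2%:~R | p in [set: int * int]].

Definition velocity (lambda : R) (j : 'I_4) : 'rV[R]_2 :=
  [:: vec2 lambda lambda; vec2 (- lambda) lambda;
      vec2 (- lambda) (- lambda); vec2 lambda (- lambda)]`_j.

Definition moment_poly (k : 'I_4) (z : 'rV[R]_2) : R :=
  let X := z 0 0 in let Y := z 0 1 in [:: 1; X; Y; X * Y]`_k.

Definition moment_mx (lambda : R) (u : 'rV[R]_2) : 'M[R]_4 :=
  \matrix_(k, j) moment_poly k (velocity lambda j - u).

(* A state assigns a distribution vector to every point of the plane.  Only its
   values on the lattice matter: transport maps the lattice to itself, and mass
   and stability below only look at lattice points. *)
Definition state := 'rV[R]_2 -> 'cV[R]_4.

Definition density (f : 'cV[R]_4) : R := \sum_(j < 4) f j 0.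

Definition relaxation (lambda : R) (u : 'rV[R]_2) (s : 'cV[R]_4)
    (meq : R -> 'cV[R]_4) (f : 'cV[R]_4) : 'cV[R]_4 :=
  let m := moment_mx lambda u *m f in
  let mstar : 'cV[R]_4 :=
    \col_k (m k 0 + s k 0 * (meq (density f) k 0 - m k 0)) in
  invmx (moment_mx lambda u) *m mstar.

Definition time_step (dx dt : R) (u : 'rV[R]_2) (s : 'cV[R]_4)
    (meq : R -> 'cV[R]_4) (f : state) : state :=
  let lambda := dx / dt in
  fun x => \col_j relaxation lambda u s meq
                    (f (x - dt *: velocity lambda j)) j 0.

(* [esum] is a sum only for nonnegative terms, hence the splitting into
   positive and negative parts. *)
Definition mass (dx : R) (f : state) : \bar R :=
  let rho x := (density (f x))%:E in
  (\esum_(x in lattice dx) rho^\+ x - \esum_(x in lattice dx) rho^\- x)%E.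

Definition nonneg_state (dx : R) (f : state) : Prop :=
  forall x, lattice dx x -> forall j, 0 <= f x j 0.

Definition Linf_stable (dx : R) (step : state -> state) : Prop :=
  forall (C : R) (f0 : state), 0 < C ->
    nonneg_state dx f0 -> (mass dx f0 <= C%:E)%E ->
    forall n : nat, nonneg_state dx (iter n step f0) /\
      (mass dx (iter n step f0) <= C%:E)%E.

Definition col4 (a b c d : R) : 'cV[R]_4 := \col_(k < 4) [:: a; b; c; d]`_k.

Definition twisted_D2Q4_MRT (dx dt sq sxy Vx Vy : R) : state -> state :=
  time_step dx dt 0 (col4 0 sq sq sxy)
    (fun rho => rho *: col4 1 Vx Vy (Vx * Vy)).

(* c is the right-hand side of the inequalities divided by 4 lambda^2. *)
Definition velocity_cond (lambda gamma c Vx Vy : R) : Prop :=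
  let Wx := Vx + Vy in
  let Wy := Vx - Vy in
  let r := 4 * lambda ^+ 2 * c in
  [/\ (Wx + 2 * lambda * gamma) ^+ 2 - Wy ^+ 2 >= r,
      (Wx - 2 * lambda * gamma) ^+ 2 - Wy ^+ 2 >= r,
      (Wy + 2 * lambda * gamma) ^+ 2 - Wx ^+ 2 >= r &
      (Wy - 2 * lambda * gamma) ^+ 2 - Wx ^+ 2 >= r].

Definition params_small_sxy (sq sxy : R) : Prop :=
  0 < sxy /\ sxy <= Num.min sq (2 - sq).

Definition params_under_relaxed (sq sxy : R) : Prop :=
  [/\ sq <= sxy, sxy <= 2 * sq, sq <= 1 & sxy != 0].

Definition params_over_relaxed (sq sxy : R) : Prop :=
  [/\ 2 - sq <= sxy, sxy <= 2 * (2 - sq), 1 <= sq & sxy != 0].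

Definition params_zero_sxy (sq sxy : R) : Prop :=
  [/\ sxy = 0, 0 < sq & sq <= 2].

Definition params_zero (sq sxy : R) : Prop := sxy = 0 /\ sq = 0.

End D2Q4.

(* Main.v *)
Require Import Defs.
From mathcomp Require Import all_boot all_order all_algebra.
From mathcomp Require Import all_classical all_reals all_analysis.
From mathcomp Require Import ring lra.

(** Why the proposition holds.  Write [s] for the relaxation parameter of the
    two first-order moments, [t] for that of the product moment, and put
    [a = Vx / lambda], [b = Vy / lambda].  The rows of the moment matrix are
    orthogonal, so it can be inverted by hand, and relaxation at a node is
    multiplication of the distribution vector by an explicit [collision]
    matrix ([relaxationE]).  Its columns sum to 1, and transport only permutes
    lattice points; hence mass is conserved as long as the distributions
    stay nonnegative, and the scheme is stable exactly when all 16 entries of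
    the collision matrix are nonnegative ([stableP]).  Sufficiency is
    reindexing of nonnegative sums; for necessity, a unit mass sitting at one
    node in velocity [k] is spread by one step into column [k] of the matrix.

    Four times the entry [(j, k)] is [drift j], which carries all the
    dependence on the velocity [V], plus a term that depends only on whether
    the directions [j] and [k] are equal, neighbouring or opposite:
    [4 - 2s - t], [t] or [2s - t].  Stability thus says that
    [drift j + c >= 0] for every [j], where [c] is the smallest of these three
    numbers ([collision_ge0P]).  The three regimes with [t > 0] are those
    where [c] is [t], [2s - t] or [4 - 2s - t]; completing the square in
    [4 * drift j / t] turns [drift j + c >= 0] into the four inequalities on
    [Wx] and [Wy] ([velocity_cond_drift]).

    Conversely the four drifts add up to zero, so that [c >= 0] whatever [V]
    is: [0 <= t], [t <= 2s] and [t <= 4 - 2s] ([collision_ge0_params]).  This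
    triangle is the union of the listed regimes and lies in [[0, 2]^2]. *)

Import Order.TTheory GRing.Theory Num.Theory.
Local Open Scope ring_scope.

(** * Directions and the collision matrix *)

Definition signx (j : 'I_4) : int := [:: 1; -1; -1; 1]`_j.
Definition signy (j : 'I_4) : int := [:: 1; 1; -1; -1]`_j.

Lemma sum_ord4 (V : nmodType) (F : 'I_4 -> V) :
  \sum_(j < 4) F j = F (@Ordinal 4 0 isT) + F (@Ordinal 4 1 isT)
                     + F (@Ordinal 4 2 isT) + F (@Ordinal 4 3 isT).
Proof.
rewrite !big_ord_recl big_ord0 addr0 !addrA.
by congr (F _ + F _ + F _ + F _); apply/val_inj.
Qed.

Section Collision.
Context {R : realType}.
Implicit Types s t a b l : R.

Definition direction (j : 'I_4) : 'rV[R]_2 :=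
  vec2 (signx j)%:~R (signy j)%:~R.

Lemma velocityE l j : velocity l j = l *: direction j.
Proof.
rewrite /velocity /direction; apply/rowP => i.
by case: j => [[|[|[|[|//]]]] ?]; rewrite /signx /signy /= !mxE;
   case: i => [[|[|//]] ?]; rewrite /= ?mulrN1 ?mulr1.
Qed.

Lemma moment_mxE l k j : moment_mx l 0 k j =
  [:: 1; l * (signx j)%:~R; l * (signy j)%:~R;
      l ^+ 2 * ((signx j)%:~R * (signy j)%:~R)]`_k.
Proof.
rewrite mxE subr0 velocityE /moment_poly !mxE /=.
by case: k => [[|[|[|[|//]]]] ?] //=; rewrite expr2 mulrACA.
Qed.

(** The four characters [1], [signx], [signy] and [signx * signy] of the group
    of signs are orthogonal with square norm 4, so the transpose of the moment
    matrix is an inverse after rescaling. *)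
Lemma moment_mx_unit l : l != 0 -> moment_mx l 0 \in unitmx.
Proof.
move=> l0; pose N : 'M[R]_4 := \matrix_(j, k)
  (4^-1 * [:: 1; l^-1 * (signx j)%:~R; l^-1 * (signy j)%:~R;
              l ^- 2 * ((signx j)%:~R * (signy j)%:~R)]`_k).
suff /mulmx1_unit[] : N *m moment_mx l 0 = 1%:M by [].
apply/matrixP => i j; rewrite mxE sum_ord4 !moment_mxE !mxE.
by case: i => [[|[|[|[|//]]]] ?]; case: j => [[|[|[|[|//]]]] ?];
   rewrite /signx /signy /=; field.
Qed.

(** In terms of characters: the constant one is kept, the other three are
    multiplied by [1 - s], [1 - s] and [1 - t] and shifted towards the
    equilibrium of density 1, whose coordinates are [a], [b] and [a * b]. *)
Definition collision s t a b : 'M[R]_4 := \matrix_(j, k)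
  (4^-1 * (1 + (signx j)%:~R * ((1 - s) * (signx k)%:~R + s * a)
             + (signy j)%:~R * ((1 - s) * (signy k)%:~R + s * b)
             + (signx j)%:~R * (signy j)%:~R *
               ((1 - t) * ((signx k)%:~R * (signy k)%:~R) + t * (a * b)))).

(** Multiplying both sides by the moment matrix reduces this to the fact that
    the moments of [collision *m f] are the relaxed moments of [f]. *)
Lemma relaxationE l s t Vx Vy (f : 'cV[R]_4) : l != 0 ->
  relaxation l 0 (col4 0 s s t) (fun rho => rho *: col4 1 Vx Vy (Vx * Vy)) f =
  collision s t (Vx / l) (Vy / l) *m f.
Proof.
move=> l0; rewrite /relaxation; apply: canLR (mulKmx (moment_mx_unit _ l0)) _.
apply/matrixP => i z; rewrite (ord1 z) {z}.
rewrite !mxE /density !sum_ord4 !moment_mxE !mxE !sum_ord4 !mxE.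
by case: i => [[|[|[|[|//]]]] ?]; rewrite /signx /signy /=; field.
Qed.

Lemma collision_density s t a b (f : 'cV[R]_4) :
  density (collision s t a b *m f) = density f.
Proof.
by rewrite /density !sum_ord4 !mxE !sum_ord4 !mxE /signx /signy /=; field.
Qed.

(** * Nonnegativity of the collision matrix *)

Definition drift s t a b (j : 'I_4) : R :=
  s * ((signx j)%:~R * a + (signy j)%:~R * b)
  + t * ((signx j)%:~R * (signy j)%:~R) * (a * b).

(** Four times the entry [(j, k)], minus [drift j], is [1] plus [1 - s] times
    the scalar product of the directions [j] and [k] ([2], [0] or [-2]) plus
    [1 - t] times the product of all four signs ([1], [-1] or [1]). *)
Lemma collision_ge0P s t a b :
  (forall j k, 0 <= collision s t a b j k) <->
  (forall j, [/\ 0 <= drift s t a b j + t, 0 <= drift s t a b j + (2 * s - t)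
               & 0 <= drift s t a b j + (4 - 2 * s - t)]).
Proof.
split=> [H j|H j k].
  have := (H j (@Ordinal 4 0 isT), H j (@Ordinal 4 1 isT),
           H j (@Ordinal 4 2 isT), H j (@Ordinal 4 3 isT)).
  rewrite /drift !mxE; move=> [[[]]].
  by case: j => [[|[|[|[|//]]]] ?]; rewrite /signx /signy /= => h0 h1 h2 h3;
     split; lra.
have := H j; rewrite /drift !mxE => -[].
by case: j => [[|[|[|[|//]]]] ?]; case: k => [[|[|[|[|//]]]] ?];
   rewrite /signx /signy /= => h0 h1 h2; lra.
Qed.

(** Directions 0 and 2, where the two signs agree, give the conditions on
    [Wx +- 2 lambda gamma]; directions 1 and 3 give those on
    [Wy +- 2 lambda gamma]. *)
Lemma velocity_cond_drift l s t c Vx Vy : 0 < l -> 0 < t ->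
  velocity_cond l (s / t) ((s / t) ^+ 2 - c / t) Vx Vy ->
  forall j, 0 <= drift s t (Vx / l) (Vy / l) j + c.
Proof.
move=> l0 t0 [xp xm yp ym] j.
(* multiplied by [4 l^2 / t], each drift is a square minus [Wx^2] or [Wy^2],
   up to a constant *)
have scale (p q : R) : 4 * l ^+ 2 * ((s / t) ^+ 2 - c / t) <= p ->
  q + c = t / (4 * l ^+ 2) * (p - 4 * l ^+ 2 * ((s / t) ^+ 2 - c / t)) ->
  0 <= q + c.
  move=> le_p ->; rewrite mulr_ge0 ?subr_ge0// divr_ge0 ?ltW// mulr_gt0//.
  by rewrite exprn_gt0.
rewrite /drift; case: j => [[|[|[|[|//]]]] ?]; rewrite /signx /signy /=.
- by apply: scale xp _; field; rewrite !gt_eqF.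
- by apply: scale ym _; field; rewrite !gt_eqF.
- by apply: scale xm _; field; rewrite !gt_eqF.
- by apply: scale yp _; field; rewrite !gt_eqF.
Qed.

(** Adding each of the three conditions over the four directions makes the
    drifts cancel and leaves conditions free of [a] and [b]. *)
Lemma collision_ge0_params s t a b : (forall j k, 0 <= collision s t a b j k) ->
  [/\ 0 <= t, t <= 2 * s & t <= 4 - 2 * s].
Proof.
move=> /collision_ge0P H.
have := (H (@Ordinal 4 0 isT), H (@Ordinal 4 1 isT),
         H (@Ordinal 4 2 isT), H (@Ordinal 4 3 isT)).
rewrite /drift /signx /signy /=.
by move=> [[[[? ? ?] [? ? ?]] [? ? ?]] [? ? ?]]; split; lra.
Qed.

End Collision.

(** * Transport, mass and stability *)

Section Transport.
Context {R : realType} {dx : R}.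
Local Open Scope classical_set_scope.

Lemma lattice0 : lattice dx 0.
Proof.
exists (0, 0) => //=; apply/rowP => i; rewrite !mxE.
by case: i => [[|[|//]] ?]; rewrite /= mulr0.
Qed.

Lemma lattice_shift (z : int) x j :
  lattice dx x -> lattice dx (x + (z%:~R * dx) *: direction j).
Proof.
move=> [[m n] _ <-]; exists (m + z * signx j, n + z * signy j) => //=.
apply/rowP => i; rewrite !mxE.
by case: i => [[|[|//]] ?]; rewrite /= intrD intrM; ring.
Qed.

Lemma lattice_addr x j : lattice dx x -> lattice dx (x + dx *: direction j).
Proof. by move=> /(lattice_shift 1 _ j); rewrite mul1r. Qed.

Lemma lattice_subr x j : lattice dx x -> lattice dx (x - dx *: direction j).
Proof. by move=> /(lattice_shift (-1) _ j); rewrite mulN1r scaleNr. Qed.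

Lemma lattice_subr_bij j :
  set_bij (lattice dx) (lattice dx) (fun x => x - dx *: direction j).
Proof.
split=> [x /lattice_subr//|x y _ _ /addIr//|x /= xL].
by exists (x + dx *: direction j); [exact: lattice_addr | rewrite addrK].
Qed.

Lemma density_ge0 (f : 'cV[R]_4) : (forall j, 0 <= f j 0) -> 0 <= density f.
Proof. by move=> f0; apply: sumr_ge0. Qed.

Lemma mass_nonneg (f : state R) : nonneg_state dx f ->
  mass dx f = (\esum_(x in lattice dx) (density (f x))%:E)%R.
Proof.
move=> f0; have rho0 x : lattice dx x -> (0 <= (density (f x))%:E)%E.
  by move=> xL; rewrite lee_fin; apply/density_ge0/f0.
rewrite /mass [X in (_ - X)%E]esum1 ?sube0.
  by apply: eq_esum => x xL; rewrite (ge0_funeposE rho0)// inE.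
by move=> x xL; rewrite (ge0_funenegE rho0)// inE.
Qed.

Variables (dt s t Vx Vy : R).
Hypotheses (dx_gt0 : 0 < dx) (dt_gt0 : 0 < dt).
Let C := collision s t (Vx / (dx / dt)) (Vy / (dx / dt)).
Let step := twisted_D2Q4_MRT dx dt s t Vx Vy.

Lemma stepE (f : state R) x j :
  step f x j 0 = (C *m f (x - dx *: direction j)) j 0.
Proof.
rewrite mxE velocityE scalerA (mulrC dt) divfK ?gt_eqF//.
by rewrite relaxationE// mulf_neq0 ?invr_eq0 ?gt_eqF.
Qed.

Lemma step_nonneg (f : state R) : (forall j k, 0 <= C j k) ->
  nonneg_state dx f -> nonneg_state dx (step f).
Proof.
move=> C0 f0 x xL j; rewrite stepE mxE; apply: sumr_ge0 => k _.
by rewrite mulr_ge0//; apply/f0/lattice_subr.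
Qed.

(** The mass is split into the contributions of the four velocities, each of
    which is shifted back along its own direction; the columns of the
    collision matrix then recombine to the density.  The sums may be infinite,
    but being nonnegative they can still be exchanged and reindexed. *)
Lemma mass_step (f : state R) : (forall j k, 0 <= C j k) ->
  nonneg_state dx f -> mass dx (step f) = mass dx f.
Proof.
move=> C0 f0; rewrite !mass_nonneg//; last exact: step_nonneg.
have Cf0 x j : lattice dx x -> (0 <= ((C *m f x) j 0)%:E)%E.
  move=> xL; rewrite lee_fin mxE; apply: sumr_ge0 => k _.
  by rewrite mulr_ge0//; apply: f0.
under eq_esum do rewrite /density -sumEFin.
rewrite esum_sum; last first.
  by move=> x j xL _; rewrite stepE Cf0//; exact: lattice_subr.
under [RHS]eq_esum do rewrite -(collision_density s t (Vx / (dx / dt))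
  (Vy / (dx / dt))) -/C /density -sumEFin.
rewrite esum_sum; last by move=> x j xL _; exact: Cf0.
apply: eq_bigr => j _; rewrite [RHS](reindex_esum _ _ _ _ (lattice_subr_bij j)).
by apply: eq_esum => x _; rewrite stepE.
Qed.

Lemma mass_point (k : 'I_4) :
  mass dx (fun x => if x == 0 then delta_mx k 0 else 0) = 1%E.
Proof.
rewrite mass_nonneg; last first.
  by move=> x _ j; case: ifP; rewrite !mxE// => _; case: ifP.
rewrite (_ : 1%E = (\esum_(x in [set (0 : 'rV[R]_2)]) 1%E)%R); last first.
  by rewrite esum_set1.
rewrite -[in RHS](@setIidr _ (lattice dx) [set 0]); last first.
  by move=> x ->; exact: lattice0.
rewrite esum_mkcondr; apply: eq_esum => x _.
rewrite in_set1; case: ifP => _; rewrite /density.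
  by rewrite (bigD1 k)//= big1 ?addr0 => [|i /negPf ik]; rewrite !mxE ?ik ?eqxx.
by rewrite big1// => i _; rewrite mxE.
Qed.

(** A negative entry [(j, k)] shows up after one step as the value in
    direction [j] of a state that starts from a point mass in direction
    [k]. *)
Lemma stableP : Linf_stable dx step <-> (forall j k, 0 <= C j k).
Proof.
split=> [st j k|C0 M f0 M0 f0_ge0 f0_le n].
  pose f0 : state R := fun x => if x == 0 then delta_mx k 0 else 0.
  have f0_ge0 : nonneg_state dx f0.
    by move=> x _ i; rewrite /f0; case: ifP; rewrite !mxE// => _; case: ifP.
  have [] := st 1 f0 ltr01 f0_ge0 _ 1%N; first by rewrite mass_point.
  move=> /(_ _ (lattice_addr _ j lattice0) j) /=.
  by rewrite stepE addrK /f0 eqxx -colE mxE.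
suff [fn_ge0 ->] : nonneg_state dx (iter n step f0) /\
    mass dx (iter n step f0) = mass dx f0 by [].
elim: n => //= n [fn_ge0 fnE]; split; first exact: step_nonneg.
by rewrite mass_step.
Qed.

End Transport.

(** * The stability regions *)

Theorem proposition3p3 (R : realType) (dx dt : R) (dx_gt0 : 0 < dx)
    (dt_gt0 : 0 < dt) :
  let lambda := dx / dt in
  let stable sq sxy Vx Vy :=
    Linf_stable dx (twisted_D2Q4_MRT dx dt sq sxy Vx Vy) in
  (forall sq sxy : R,
    let gamma := sq / sxy in
    (params_small_sxy sq sxy ->
      forall Vx Vy : R,
        velocity_cond lambda gamma (gamma ^+ 2 - 1) Vx Vy ->
        stable sq sxy Vx Vy) /\
    (params_under_relaxed sq sxy ->
      forall Vx Vy : R,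
        velocity_cond lambda gamma ((gamma - 1) ^+ 2) Vx Vy ->
        stable sq sxy Vx Vy) /\
    (params_over_relaxed sq sxy ->
      forall Vx Vy : R,
        velocity_cond lambda gamma ((gamma + 1) ^+ 2 - 4 / sxy) Vx Vy ->
        stable sq sxy Vx Vy) /\
    (params_zero_sxy sq sxy -> stable sq sxy 0 0) /\
    (params_zero sq sxy -> forall Vx Vy : R, stable sq sxy Vx Vy) /\
    (~ (params_small_sxy sq sxy \/ params_under_relaxed sq sxy \/
        params_over_relaxed sq sxy \/ params_zero_sxy sq sxy \/
        params_zero sq sxy) ->
      ~ exists Vx Vy : R, stable sq sxy Vx Vy)) /\
  (forall sq sxy : R, (exists Vx Vy : R, stable sq sxy Vx Vy) ->
    (0 <= sq /\ sq <= 2) /\ (0 <= sxy /\ sxy <= 2)).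
Proof.
move=> lambda stable.
have lambda_gt0 : 0 < lambda by rewrite divr_gt0.
have stable_params s t : (exists Vx Vy, stable s t Vx Vy) ->
    [/\ 0 <= t, t <= 2 * s & t <= 4 - 2 * s].
  by move=> [Vx [Vy /(stableP _ _ _ _ _ dx_gt0 dt_gt0)/collision_ge0_params]].
have stable_bound s t c Vx Vy : 0 < t -> [/\ c <= t, c <= 2 * s - t
    & c <= 4 - 2 * s - t] ->
    velocity_cond lambda (s / t) ((s / t) ^+ 2 - c / t) Vx Vy ->
    stable s t Vx Vy.
  move=> t0 [c1 c2 c3] Vcond; apply/stableP => //; apply/collision_ge0P => j.
  have := velocity_cond_drift _ _ _ _ _ _ lambda_gt0 t0 Vcond j.
  by rewrite -/lambda => ?; split; lra.
split=> [s t gamma|s t /stable_params[? ? ?]]; last by split; split; lra.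
split=> [[t0]|]; last split; last split; last split; last split.
- rewrite le_min => /andP[ts t2s] Vx Vy Vcond.
  apply: (stable_bound _ _ t) => //; first by split; lra.
  by rewrite divff ?gt_eqF.
- move=> [st ts s1 tN0] Vx Vy Vcond.
  have t0 : 0 < t by rewrite lt_def tN0 /=; lra.
  apply: (stable_bound _ _ (2 * s - t)) => //; first by split; lra.
  by rewrite (_ : _ - _ = (gamma - 1) ^+ 2)// /gamma; field.
- move=> [st ts s1 tN0] Vx Vy Vcond.
  have t0 : 0 < t by rewrite lt_def tN0 /=; lra.
  apply: (stable_bound _ _ (4 - 2 * s - t)) => //; first by split; lra.
  by rewrite (_ : _ - _ = (gamma + 1) ^+ 2 - 4 / t)// /gamma; field.
- move=> [t0 s0 s2]; apply/stableP => //; apply/collision_ge0P => j.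
  by rewrite /drift t0 !mul0r !mulr0 !addr0; split; lra.
- move=> [t0 s0] Vx Vy; apply/stableP => //; apply/collision_ge0P => j.
  by rewrite /drift t0 s0 !mul0r !addr0; split; lra.
(* The triangle of admissible parameters is covered by the regimes. *)
move=> other /stable_params[t0 ts t2s]; apply: other.
case: (eqVneq t 0) => [t_eq0|tN0].
  case: (eqVneq s 0) => [s_eq0|sN0]; first by do 4 right.
  do 3 right; left; split=> //; last by lra.
  by rewrite lt_def sN0 /=; lra.
case: (leP t (Num.min s (2 - s))) => [le_t|].
  by left; rewrite /params_small_sxy lt_def tN0.
rewrite gt_min => lt_t; case: (leP s 1) => s1.
  by right; left; split=> //; case/orP: lt_t => ?; lra.
by do 2 right; left; split=> //; case/orP: lt_t => ?; lra.
Qed.
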